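(* Let $p$ be a prime. Every finite $p$-group $P$ has a finite presentation $\langle\,X\mid R\,\rangle$ such that $\mu_x(r)\equiv 0\pmod p$ for all $x\in X$ and $r\in R$.
   Context: Let $F=F\langle X\rangle$ be the free group with basis $X$. Every $w\in F$ can be written in the form $w=x_1^{\varepsilon_1}\cdots x_t^{\varepsilon_t}$, where $x_i\in X$ and $\varepsilon_i=\pm 1$. For $x\in X$, define $\mu_x(w)=\sum_{\{i\,\mid\, x_i=x\}} \varepsilon_i$, the exponent sum of $x$ in $w$ (it does not depend on the chosen expression of $w$). In a presentation $\langle\,X\mid R\,\rangle$, the relators $r\in R$ are elements of $F\langle X\rangle$; the presentation is finite if both $X$ and $R$ are finite. *)

(* Defs.v *)
From HB Require Import structures.
From mathcomp Require Import all_boot all_order all_algebra all_fingroup all_solvable.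

Set Implicit Arguments.
Unset Strict Implicit.
Unset Printing Implicit Defensive.

Import GRing.Theory.

Local Open Scope group_scope.

Section FreeGroup.

Variable X : choiceType.

(* The letter (x, e) stands for x^(-1)^e: x if e = false, x^-1 if e = true. *)
Definition letter : Type := (X * bool)%type.

Implicit Types (l : letter) (u v w : seq letter).

Definition letter_inv l : letter := (l.1, ~~ l.2).

Definition reduced w := sorted (fun l1 l2 => l2 != letter_inv l1) w.

Definition push l w :=
  if w is l' :: w' then if l' == letter_inv l then w' else l :: w
  else [:: l].

Definition reduce w := foldr push [::] w.

Lemma letter_invK : involutive letter_inv.
Proof. by case=> x e; rewrite /letter_inv negbK. Qed.

Lemma push_reduced l w : reduced w -> reduced (push l w).
Proof.
case: w => //= l' w rw; case: eqP => [_|/eqP ne]; first exact: path_sorted rw.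
by rewrite /reduced /= ne.
Qed.

Lemma foldr_push_reduced u v : reduced v -> reduced (foldr push v u).
Proof. by move=> rv; elim: u => //= l u; apply: push_reduced. Qed.

Lemma reduce_reduced w : reduced (reduce w).
Proof. exact: foldr_push_reduced. Qed.

Lemma pushK l w : reduced w -> push l (push (letter_inv l) w) = w.
Proof.
case: w => [|l' w] /=; first by rewrite eqxx.
rewrite letter_invK; case: eqP => [->|_] /=; last by rewrite eqxx.
by case: w => //= l1 w /andP[/negbTE->].
Qed.

Lemma foldr_push_push l u v :
  reduced v -> foldr push v (push l u) = push l (foldr push v u).
Proof.
case: u => [|l' u] //= rv; case: eqP => [->|//].
by rewrite pushK ?foldr_push_reduced.
Qed.

Lemma foldr_push_reduce u v :
  reduced v -> foldr push v (reduce u) = foldr push v u.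
Proof. by move=> rv; elim: u => //= l u IHu; rewrite foldr_push_push ?IHu. Qed.

Lemma reduce_id w : reduced w -> reduce w = w.
Proof.
elim: w => //= l w IHw rw; rewrite IHw; last exact: path_sorted rw.
by case: w rw {IHw} => //= l' w /andP[/negbTE->].
Qed.

Lemma reduce_cat u v : reduce (u ++ v) = foldr push (reduce v) u.
Proof. exact: foldr_cat. Qed.

Record free_group :=
  FreeGroup { fg_word :> seq letter; fg_word_reduced : reduced fg_word }.

HB.instance Definition _ := [isSub for fg_word].
HB.instance Definition _ := [Choice of free_group by <:].

Definition fg_of_word w : free_group := FreeGroup (reduce_reduced w).

Definition fg_gen (x : X) : free_group := fg_of_word [:: (x, false)].

Definition fg_one : free_group := fg_of_word [::].
Definition fg_mul (a b : free_group) := fg_of_word (a ++ b).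
Definition fg_inv (a : free_group) := fg_of_word (rev (map letter_inv a)).

Lemma fg_mulA : associative fg_mul.
Proof.
move=> a b c; apply: val_inj => /=; rewrite reduce_cat.
rewrite [in RHS]reduce_cat [in RHS]foldr_push_reduce ?reduce_reduced //.
by rewrite foldr_cat [reduce (reduce _)]reduce_id ?reduce_reduced // reduce_cat.
Qed.

Lemma fg_mul1 : left_id fg_one fg_mul.
Proof. by case=> w rw; apply: val_inj; rewrite /= reduce_id. Qed.

Lemma fg_mulr1 : right_id fg_one fg_mul.
Proof. by case=> w rw; apply: val_inj; rewrite /= cats0 reduce_id. Qed.

Lemma reduce_invw w : reduce (rev (map letter_inv w) ++ w) = [::].
Proof.
elim: w => //= l w IHw; rewrite rev_cons cat_rcons reduce_cat /=.
by have:= pushK (letter_inv l) (reduce_reduced w); rewrite letter_invK => ->;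
  rewrite -reduce_cat.
Qed.

Lemma fg_mulVg : left_inverse fg_one fg_inv fg_mul.
Proof.
move=> a; apply: val_inj => /=.
by rewrite reduce_cat foldr_push_reduce ?reduce_reduced // -reduce_cat
           reduce_invw.
Qed.

Lemma fg_mulgV : right_inverse fg_one fg_inv fg_mul.
Proof.
move=> a; have inv_inv: fg_mul (fg_inv (fg_inv a)) (fg_inv a) = fg_one
  by apply: fg_mulVg.
rewrite -[fg_mul a _]fg_mul1 -{1}inv_inv -fg_mulA [fg_mul (fg_inv a) _]fg_mulA.
by rewrite fg_mulVg fg_mul1.
Qed.

HB.instance Definition _ :=
  isGroup.Build free_group fg_mulA fg_mul1 fg_mulr1 fg_mulVg fg_mulgV.

Lemma fg_of_wordM u v : fg_of_word (u ++ v) = fg_of_word u * fg_of_word v.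
Proof.
apply: val_inj; rewrite /= !reduce_cat.
by rewrite foldr_push_reduce ?reduce_reduced // [reduce (reduce v)]reduce_id
           ?reduce_reduced.
Qed.

Lemma fg_wordK (a : free_group) : fg_of_word a = a.
Proof. by apply: val_inj; rewrite /= reduce_id // fg_word_reduced. Qed.

Lemma fg_of_wordE w :
  fg_of_word w = \prod_(l <- w) (if l.2 then (fg_gen l.1)^-1 else fg_gen l.1).
Proof.
elim: w => [|[x e] w IHw]; first by rewrite big_nil.
by rewrite big_cons -IHw -cat1s fg_of_wordM; congr (_ * _); case: e;
  apply: val_inj.
Qed.

Definition word_mu (x : X) w : int :=
  (\sum_(l <- w | l.1 == x) (-1) ^+ l.2)%R.

(* The exponent sum of x, read off the reduced expression; by [mu_of_word] any
   other expression gives the same value. *)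
Definition mu (x : X) (a : free_group) : int := word_mu x a.

Lemma word_mu_push x l w : word_mu x (push l w) = word_mu x (l :: w).
Proof.
case: w => [|l' w] //=; case: eqP => [->|//]; case: l => y e.
rewrite /word_mu !big_cons /=; case: eqP => // _.
by rewrite signrN addrA subrr add0r.
Qed.

Lemma mu_of_word x w : mu x (fg_of_word w) = word_mu x w.
Proof.
rewrite /mu /=; elim: w => //= l w IHw; rewrite word_mu_push.
by move: IHw; rewrite /word_mu !big_cons => ->.
Qed.

Lemma muM x (a b : free_group) : mu x (a * b) = (mu x a + mu x b)%R.
Proof. by rewrite [LHS]mu_of_word /word_mu big_cat. Qed.

Section Lift.

Variables (G : groupType) (f : X -> G).

Definition word_lift w : G :=
  \prod_(l <- w) (if l.2 then (f l.1)^-1 else f l.1).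

Definition fg_lift (a : free_group) : G := word_lift a.

Lemma word_lift_push l w : word_lift (push l w) = word_lift (l :: w).
Proof.
case: w => [|l' w] //=; case: eqP => [->|//]; case: l => y e.
rewrite /word_lift !big_cons /= mulgA.
by case: e; rewrite /= ?mulVg ?mulgV mul1g.
Qed.

Lemma word_lift_reduce w : word_lift (reduce w) = word_lift w.
Proof.
elim: w => //= l w IHw; rewrite word_lift_push.
by move: IHw; rewrite /word_lift !big_cons => ->.
Qed.

Lemma fg_lift_multiplicative : {morph fg_lift : a b / a * b}.
Proof. by move=> a b; rewrite [LHS]word_lift_reduce /word_lift big_cat. Qed.

HB.instance Definition _ :=
  isMultiplicative.Build free_group G fg_lift fg_lift_multiplicative.

Lemma fg_lift_gen x : fg_lift (fg_gen x) = f x.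
Proof. by rewrite /fg_lift /word_lift /= big_seq1. Qed.

Lemma fg_lift_unique (g : {multiplicative free_group -> G}) :
  (forall x, g (fg_gen x) = f x) -> g =1 fg_lift.
Proof.
move=> gE a; rewrite -{1}[a]fg_wordK fg_of_wordE.
have g1: g 1 = 1 by apply: (mulgI (g 1)); rewrite -gmulfM !mulg1.
have gV b: g b^-1 = (g b)^-1.
  by apply: (mulgI (g b)); rewrite -gmulfM !mulgV g1.
rewrite (big_morph g (@gmulfM _ _ g) g1); apply: eq_bigr => -[x e] _ /=.
by case: e; rewrite ?gV gE.
Qed.

End Lift.

End FreeGroup.

Inductive normal_closure (G : groupType) (R : seq G) : G -> Prop :=
| normal_closure_mem r : r \in R -> normal_closure R r
| normal_closure1 : normal_closure R 1
| normal_closureM a b :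
    normal_closure R a -> normal_closure R b -> normal_closure R (a * b)
| normal_closureV a : normal_closure R a -> normal_closure R a^-1
| normal_closureJ a b : normal_closure R a -> normal_closure R (a ^ b).

(* <X | R> is a presentation of P: some epimorphism from the free group on X
   onto P has the normal closure of R as kernel. *)
Definition finite_presentation (X : finType) (R : seq (free_group X))
    (gT : finGroupType) (P : {group gT}) : Prop :=
  exists f : {multiplicative free_group X -> gT},
    (forall g, g \in P <-> exists a, f a = g) /\
    (forall a, f a = 1 <-> normal_closure R a).

(* Main.v *)
Require Import Defs.
From mathcomp Require Import all_boot all_order all_algebra all_fingroup all_solvable.

(** Take a generating set X of P that is minimal for inclusion and let f be the
    canonical map from the free group on X onto P. By minimality, for each x in
    X the subgroup generated by X minus x lies in some maximal subgroup M, which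
    is normal of index p. Modulo M a relator r becomes the power mu_x(r) of the
    class of x, an element of order p; hence p divides mu_x(r). Finitely many
    relators suffice: choosing a preimage t(g) of every g in P, the kernel is
    generated by t(1) and the elements t(g) x t(g f(x))^-1, since these allow one
    to rewrite any word w as t(f(w)), letter by letter from the left. *)

Set Implicit Arguments.
Unset Strict Implicit.
Unset Printing Implicit Defensive.

Import GRing.Theory.

Local Open Scope group_scope.

Lemma word_lift_rcons (X : choiceType) (G : groupType) (h : X -> G) w l :
  word_lift h (rcons w l)
  = word_lift h w * (if l.2 then (h l.1)^-1 else h l.1).
Proof. by rewrite /word_lift -cats1 big_cat big_seq1. Qed.

Lemma word_lift_cons (X : choiceType) (G : groupType) (h : X -> G) w l :
  word_lift h (l :: w) = (if l.2 then (h l.1)^-1 else h l.1) * word_lift h w.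
Proof. by rewrite /word_lift big_cons. Qed.

(** Group powers take natural exponents, so the signed sum is split into two counts that can serve
    as such exponents. *)
Lemma word_mu_count (X : choiceType) (x : X) (w : seq (letter X)) :
  word_mu x w =
    ((count_mem (x, false) w)%:Z - (count_mem (x, true) w)%:Z)%R.
Proof.
elim: w => [|[y e] w IHw]; first by rewrite /word_mu big_nil.
rewrite /word_mu big_cons -/(word_mu x w) IHw /= !xpair_eqE.
case: eqP => //= _; case: e; rewrite /= ?expr1 ?expr0 ?add0n PoszD.
  by rewrite opprD addrCA.
by rewrite addrA.
Qed.

(** Every factor is 1 or a power of [h x]; these commute, so positive and negative letters can be
    collected separately. *)
Lemma word_lift_supported1 (X : choiceType) (G : groupType) (h : X -> G)
    (x : X) (w : seq (letter X)) :
  (forall y, y != x -> h y = 1) ->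
  word_lift h w
  = h x ^+ count_mem (x, false) w * h x ^- count_mem (x, true) w.
Proof.
move=> h1; elim: w => [|[y e] w IHw].
  by rewrite /word_lift big_nil /= invg1 mulg1.
rewrite word_lift_cons IHw /= !xpair_eqE.
have [->|/h1->] := eqVneq y x; last by rewrite invg1 if_same mul1g.
case: e => /=; rewrite add0n add1n expgS ?mulgA //.
rewrite -expgS expgSr invMg mulgA; congr (_ * _).
by apply/commuteX/commute_sym/commuteV.
Qed.

Lemma word_lift_in (X : choiceType) (gT : finGroupType) (h : X -> gT)
    (P : {group gT}) w :
  (forall x, h x \in P) -> word_lift h w \in P.
Proof.
by move=> hP; apply: group_prod => -[x []] _ //=; rewrite groupV.
Qed.

Lemma coset_word_lift (X : choiceType) (gT : finGroupType) (h : X -> gT)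
    (M : {group gT}) w :
  (forall x, h x \in 'N(M)) ->
  coset M (word_lift h w) = word_lift (coset M \o h) w.
Proof.
move=> hN; elim: w => [|[x e] w IHw]; first by rewrite /word_lift !big_nil morph1.
have wN : word_lift h w \in 'N(M) by apply: word_lift_in.
by rewrite !word_lift_cons -IHw; case: e; rewrite /= morphM ?morphV ?groupV.
Qed.

Lemma fg_lift_image (X : finType) (gT : finGroupType) (h : X -> gT) g :
  g \in <<h @: X>> <-> exists a, fg_lift h a = g.
Proof.
split=> [/gen_prodgP[n [c cX ->]] | [a <-]].
  have [y cE]: exists y, forall i, h (y i) = c i.
    apply: (fin_all_exists (P := fun i y => h y = c i)) => i.
    by case/imsetP: (cX i) => y _ ->; exists y.
  (* Positive letters suffice: in a finite group the generated subgroup consists of products of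
     generators. *)
  exists (fg_of_word [seq (y i, false) | i <- index_enum 'I_n]).
  rewrite /fg_lift word_lift_reduce /word_lift big_map.
  by apply: eq_bigr => i _; rewrite cE.
by apply: word_lift_in => x; rewrite mem_gen ?imset_f.
Qed.

Lemma fg_lift_presentation (X : finType) (gT : finGroupType) (P : {group gT})
    (h : X -> gT) :
  <<h @: X>> = P ->
  exists R : seq (free_group X),
    (forall r, r \in R -> fg_lift h r = 1) /\ finite_presentation R P.
Proof.
move=> genP; pose f : {multiplicative free_group X -> gT} := fg_lift h.
have f1 : f 1 = 1 by apply: (mulgI (f 1)); rewrite -gmulfM !mulg1.
have fV b : f b^-1 = (f b)^-1.
  by apply: (mulgI (f b)); rewrite -gmulfM !mulgV f1.
have fP g : g \in P <-> exists a, f a = g by rewrite -genP; apply: fg_lift_image.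
have fw w : f (fg_of_word w) = word_lift h w by apply: word_lift_reduce.
have hP x : h x \in P by rewrite -genP mem_gen ?imset_f.
have [t tE]: exists t, forall g, g \in P -> f (t g) = g.
  apply: (fin_all_exists (P := fun g b => g \in P -> f b = g)) => g.
  case: (boolP (g \in P)) => [/fP[a <-]|_]; first by exists a.
  (* Outside [P] there is no preimage; the default 1 only makes [t] total. *)
  by exists 1.
pose rel g x := t g * fg_gen x * (t (g * h x))^-1.
pose R := t 1 :: [seq rel g x | g <- enum P, x <- enum X].
have R1 r : r \in R -> f r = 1.
  rewrite inE => /predU1P[->|]; first by rewrite tE.
  case/allpairsP=> -[g x] /= [gP _ ->]; rewrite mem_enum in gP.
  rewrite /rel !gmulfM fV !tE ?groupM //.
  by rewrite [f (fg_gen x)]fg_lift_gen mulgV.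
have relR g x : g \in P -> normal_closure R (rel g x).
  move=> gP; apply: normal_closure_mem; rewrite inE; apply/orP; right.
  by apply/allpairsP; exists (g, x); rewrite !mem_enum.
exists R; split=> //; exists f; split=> // a; split; last first.
  elim=> {a} [r /R1 // | // | a b _ fa _ fb | a _ fa | a b _ fa].
  - by rewrite gmulfM fa fb mulg1.
  - by rewrite fV fa invg1.
  - by rewrite conjgE !gmulfM fV fa mul1g mulVg.
have NR w : normal_closure R (fg_of_word w * (t (word_lift h w))^-1).
  elim/last_ind: w => [|w [x e] IHw].
    rewrite /word_lift big_nil -[fg_of_word _]/(1 : free_group X) mul1g.
    by apply/normal_closureV/normal_closure_mem; rewrite mem_head.
  set g := word_lift h w in IHw.
  have gP : g \in P by apply: word_lift_in.
  rewrite -cats1 fg_of_wordM cats1 word_lift_rcons -/g /=.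
  (* Inserting [t g] after its inverse splits off the factor covered by [IHw]; what remains is t(g)
     x^e t(g h(x)^e)^-1, where e is 1 or -1. *)
  rewrite -[fg_of_word w](mulgKV (t g)) -!mulgA.
  rewrite mulgA; apply: normal_closureM => //; rewrite mulgA.
  case: e => /=; last exact: relR.
  have -> : fg_of_word [:: (x, true)] = (fg_gen x)^-1 by apply: val_inj.
  (* For the letter x^-1 the remaining factor is the inverse of the relator [rel] at g h(x)^-1 and
     x. *)
  have /normal_closureV := relR _ x (groupM gP (groupVr (hP x))).
  by rewrite /rel mulgKV !invMg invgK !mulgA.
(* The choice [t 1] need not be trivial, which is why it was put among the relators. *)
move=> fa; have := NR a; rewrite -fw fg_wordK fa => Na.
rewrite -[a](mulgKV (t 1)); apply: normal_closureM => //.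
by apply: normal_closure_mem; rewrite mem_head.
Qed.

Lemma pgroup_relator_mu (p : nat) (X : finType) (gT : finGroupType)
    (P : {group gT}) (h : X -> gT) (x : X) (r : free_group X) :
  prime p -> p.-group P -> <<h @: X>> = P -> <<h @: [set~ x]>> != P ->
  fg_lift h r = 1 -> (mu x r = 0 %[mod p])%Z.
Proof.
move=> p_pr pP genP minP r1.
have hP y : h y \in P by rewrite -genP mem_gen ?imset_f.
have sHP : <<h @: [set~ x]>> \subset P.
  by rewrite gen_subG; apply/subsetP=> _ /imsetP[y _ ->].
have [eqP | [M maxM sHM]] := maximal_exists sHP.
  by rewrite eqP eqxx in minP.
have nsMP := p_maximal_normal pP maxM; have nMP := normal_norm nsMP.
have hN y : h y \in 'N(M) by apply: (subsetP nMP).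
have hM y : y != x -> h y \in M.
  by move=> yx; rewrite (subsetP sHM) ?mem_gen ?imset_f ?inE.
pose u := coset M (h x).
have u_neq1 : u != 1.
  (* If [h x] were in [M], then [M] would contain all generators and could not be proper. *)
  apply: contraTN (proper_subn (maxgroupp maxM)) => /eqP/coset_idr hxM.
  rewrite negbK -genP gen_subG; apply/subsetP=> _ /imsetP[y _ ->].
  by have [->|/hM] := eqVneq y x; first apply: hxM.
have ou : #[u] = p.
  apply/prime_nt_dvdP; rewrite ?order_eq1 // -(p_maximal_index pP maxM).
  by rewrite -card_quotient ?order_dvdG ?mem_quotient.
have : word_lift (coset M \o h) r = 1.
  by rewrite -coset_word_lift // -[word_lift h r]/(fg_lift h r) r1 morph1.
(* The other generators vanish modulo [M], so u^m = u^n, where m and n count the letters x and x^-1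
   in [r]. *)
rewrite (@word_lift_supported1 _ _ _ x) /= -/u => [|y /hM yM]; last exact: coset_id.
move/(canRL (mulgKV _)); rewrite mul1g => /eqP.
rewrite eq_expg_mod_order ou => /eqP mn.
apply/eqP; rewrite eqz_mod_dvd subr0 /mu word_mu_count -eqz_mod_dvd.
by apply/eqP; rewrite !modz_nat mn.
Qed.

Theorem proposition2 (p : nat) (p_prime : prime p)
    (gT : finGroupType) (P : {group gT}) (pP : (p.-group P)%g) :
  exists (X : finType) (R : seq (free_group X)),
    finite_presentation R P /\
    (forall (x : X) (r : free_group X),
       r \in R -> (mu x r = 0 %[mod p])%Z).
Proof.
have [A /minsetP[/eqP genA minA] _] :=
  @minset_exists _ (fun A : {set gT} => <<A>> == P) P
    (introT eqP (genGid P)).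
(* Indexing the generators by the elements of [A] makes [h] injective. *)
pose h (y : {y | y \in A}) := val y.
have genP : <<h @: {: {y | y \in A}}>> = P.
  rewrite -genA; congr <<_>>; apply/setP=> y.
  apply/imsetP/idP => [[z _ ->]|yA]; first exact: valP.
  by exists (exist _ y yA).
have [R [R1 presR]] := fg_lift_presentation genP.
exists {y | y \in A}, R; split=> // x r /R1 r1.
apply: pgroup_relator_mu (p_prime) pP genP _ r1.
apply/negP => genx.
have sub : h @: [set~ x] \subset A.
  by apply/subsetP=> _ /imsetP[z _ ->]; apply: valP.
have hxA : h x \in A := valP x.
(* If the generators other than [x] sufficed, minimality would make their image all of [A], against
   injectivity of [h]. *)
have : h x \in h @: [set~ x] by rewrite (minA _ genx sub).
case/imsetP=> z; rewrite !inE => /negP zx /val_inj xz.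
by apply: zx; rewrite xz.
Qed.
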